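(* Let $t\in\mathbb R\setminus\{0\}$. For every $n\in\mathbb N$ the function $q_t\mapsto q_t^n$ is in $\ker V_t$ on $\mathbb H_t^*$, and moreover, on $\mathbb H_t^*$, $$q_t^n=\sum_{\alpha\in\mathbb N_0^3,\ |\alpha|=n}\mu_t^\alpha\, c_{\alpha,n},\qquad c_{\alpha,n}=\frac{n!}{\alpha!}\; i^{\times\alpha_1}\times j_t^{\times\alpha_2}\times k_t^{\times\alpha_3},\quad \alpha=(\alpha_1,\alpha_2,\alpha_3).$$
   Context: For $t\in\mathbb R\setminus\{0\}$, $\mathbb H_t$ is the real associative unital algebra with basis $1,i,j_t,k_t$, where $i^2=-1$, $j_t^2=k_t^2=t$, $ij_t=k_t=-j_ti$, $j_tk_t=-ti=-k_tj_t$, $k_ti=j_t=-ik_t$. A point $x=(x_0,x_1,x_2,x_3)\in\mathbb R^4$ is identified with $q_t=x_0+x_1i+x_2j_t+x_3k_t$, with vector part $\vec{q_t}=ix_1+j_tx_2+k_tx_3$. $\mathbb H_t^*$ denotes the open set of those $q_t$ for which $\vec{q_t}$ is invertible in $\mathbb H_t$, i.e. $-x_1^2+t(x_2^2+x_3^2)\neq0$; there $\frac{1}{\vec{q_t}}$ denotes the inverse. The operator $V_t$ is $$V_tf=\frac{\partial f}{\partial x_0}-\frac{1}{\vec{q_t}}\left(x_1\frac{\partial f}{\partial x_1}+x_2\frac{\partial f}{\partial x_2}+x_3\frac{\partial f}{\partial x_3}\right).$$ Set $\mu_{l,t}(x)=x_l\left(1+\frac{x_0}{\vec{q_t}}\right)$,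 $l=1,2,3$, and, for $\alpha=(\alpha_1,\alpha_2,\alpha_3)\in\mathbb N_0^3$, $\mu_t^\alpha=\mu_{1,t}^{\alpha_1}\mu_{2,t}^{\alpha_2}\mu_{3,t}^{\alpha_3}$, $|\alpha|=\alpha_1+\alpha_2+\alpha_3$, $\alpha!=\alpha_1!\alpha_2!\alpha_3!$. The symmetrized product of $h_1,\dots,h_N\in\mathbb H_t$ is $h_1\times\cdots\times h_N=\frac1{N!}\sum_{\sigma\in S_N}h_{\sigma(1)}\cdots h_{\sigma(N)}$, and $i^{\times\alpha_1}\times j_t^{\times\alpha_2}\times k_t^{\times\alpha_3}$ is the symmetrized product of the $|\alpha|$ elements consisting of $\alpha_1$ copies of $i$, $\alpha_2$ copies of $j_t$ and $\alpha_3$ copies of $k_t$. *)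

(* Defs.v *)
From HB Require Import structures.
From mathcomp Require Import all_boot all_order all_algebra all_fingroup.
From mathcomp Require Import all_classical all_reals all_analysis.
From mathcomp Require Import ring.

Set Implicit Arguments.
Unset Strict Implicit.
Unset Printing Implicit Defensive.

Import Order.TTheory GRing.Theory Num.Theory numFieldNormedType.Exports.
Local Open Scope classical_set_scope.
Local Open Scope ring_scope.

(* The algebra H_t: the coordinates of a row are those in the basis
   1, i, j_t, k_t, so that R^4 and H_t are identified. *)
Definition Ht (R : realType) (t : R) : Type := 'rV[R]_4.

HB.instance Definition _ (R : realType) (t : R) :=
  NormedModule.on (Ht t).

Definition hq (R : realType) (t x0 x1 x2 x3 : R) : Ht t :=
  \row_(l < 4) [:: x0; x1; x2; x3]`_l.

Definition hco (R : realType) (t : R) (l : nat) (q : Ht t) : R :=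
  (q : 'rV[R]_4) 0 (inord l).

Local Notation "q '`x0'" := (hco 0 q) (at level 2, format "q '`x0'") : ring_scope.
Local Notation "q '`x1'" := (hco 1 q) (at level 2, format "q '`x1'") : ring_scope.
Local Notation "q '`x2'" := (hco 2 q) (at level 2, format "q '`x2'") : ring_scope.
Local Notation "q '`x3'" := (hco 3 q) (at level 2, format "q '`x3'") : ring_scope.

Section Algebra.
Variables (R : realType) (t : R).
Implicit Types p q r : Ht t.

Lemma hqE x0 x1 x2 x3 :
  ((hq t x0 x1 x2 x3)`x0 = x0) * ((hq t x0 x1 x2 x3)`x1 = x1) *
  ((hq t x0 x1 x2 x3)`x2 = x2) * ((hq t x0 x1 x2 x3)`x3 = x3).
Proof. by rewrite /hco !mxE !inordK. Qed.

Lemma hqP p q :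
  p`x0 = q`x0 -> p`x1 = q`x1 -> p`x2 = q`x2 -> p`x3 = q`x3 -> p = q.
Proof.
move=> e0 e1 e2 e3; apply/rowP => l; rewrite -(inord_val l).
by case: l => -[|[|[|[|]]]].
Qed.

Lemma hcoD p q l : hco l (p + q) = hco l p + hco l q.
Proof. by rewrite /hco mxE. Qed.
Lemma hcoN p l : hco l (- p) = - hco l p.
Proof. by rewrite /hco mxE. Qed.
Lemma hcoZ (a : R) p l : hco l (a *: p) = a * hco l p.
Proof. by rewrite /hco mxE. Qed.
Lemma hco0 l : hco l (0 : Ht t) = 0.
Proof. by rewrite /hco mxE. Qed.

Definition hone : Ht t := hq t 1 0 0 0.

(* Bilinear extension of the multiplication table (see Ht_table below). *)
Definition hmul p q : Ht t := hq t
  (p`x0 * q`x0 - p`x1 * q`x1 + t * (p`x2 * q`x2) + t * (p`x3 * q`x3))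
  (p`x0 * q`x1 + p`x1 * q`x0 - t * (p`x2 * q`x3) + t * (p`x3 * q`x2))
  (p`x0 * q`x2 + p`x2 * q`x0 + p`x3 * q`x1 - p`x1 * q`x3)
  (p`x0 * q`x3 + p`x3 * q`x0 + p`x1 * q`x2 - p`x2 * q`x1).

Let hE := (hqE, hcoD, hcoN, hcoZ, hco0).

Fact hmulA : associative hmul.
Proof. by move=> p q r; apply: hqP; rewrite /hmul !hE; ring. Qed.
Fact hmul1q : left_id hone hmul.
Proof. by move=> p; apply: hqP; rewrite /hmul /hone !hE; ring. Qed.
Fact hmulq1 : right_id hone hmul.
Proof. by move=> p; apply: hqP; rewrite /hmul /hone !hE; ring. Qed.
Fact hmulDl : left_distributive hmul +%R.
Proof. by move=> p q r; apply: hqP; rewrite /hmul !hE; ring. Qed.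
Fact hmulDr : right_distributive hmul +%R.
Proof. by move=> p q r; apply: hqP; rewrite /hmul !hE; ring. Qed.
Fact hone_neq0 : hone != 0.
Proof.
apply/eqP => /(congr1 (fun q => q`x0)); rewrite !hE => /eqP.
by rewrite oner_eq0.
Qed.

HB.instance Definition _ := GRing.Zmodule_isNzRing.Build (Ht t)
  hmulA hmul1q hmulq1 hmulDl hmulDr hone_neq0.

Lemma hmulE p q : p * q = hmul p q. Proof. by []. Qed.
Lemma honeE : 1 = hone. Proof. by []. Qed.

Fact hscaleAl (a : R) p q : a *: (p * q) = (a *: p) * q.
Proof. by apply: hqP; rewrite !hmulE /hmul !hE; ring. Qed.
HB.instance Definition _ := GRing.Lmodule_isLalgebra.Build R (Ht t) hscaleAl.

Fact hscaleAr (a : R) p q : a *: (p * q) = p * (a *: q).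
Proof. by apply: hqP; rewrite !hmulE /hmul !hE; ring. Qed.
HB.instance Definition _ := GRing.Lalgebra_isAlgebra.Build R (Ht t) hscaleAr.

Definition hnorm q : R :=
  q`x0 ^+ 2 + q`x1 ^+ 2 - t * (q`x2 ^+ 2 + q`x3 ^+ 2).
Definition hconj q : Ht t := hq t (q`x0) (- q`x1) (- q`x2) (- q`x3).
Definition hinv q : Ht t :=
  if hnorm q != 0 then (hnorm q)^-1 *: hconj q else q.

Lemma hnormM p q : hnorm (p * q) = hnorm p * hnorm q.
Proof. by rewrite hmulE /hmul /hnorm !hE; ring. Qed.
Lemma hnorm1 : hnorm 1 = 1.
Proof. by rewrite honeE /hone /hnorm !hE; ring. Qed.
Lemma hconjM q : hconj q * q = hnorm q *: 1.
Proof. by apply: hqP; rewrite hmulE honeE /hmul /hone /hconj /hnorm !hE; ring. Qed.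
Lemma hmul_conj q : q * hconj q = hnorm q *: 1.
Proof. by apply: hqP; rewrite hmulE honeE /hmul /hone /hconj /hnorm !hE; ring. Qed.

Fact hmulVq : {in [pred q | hnorm q != 0], left_inverse 1 hinv *%R}.
Proof.
move=> q; rewrite inE => nq; rewrite /hinv nq -scalerAl hconjM.
by rewrite scalerA mulVf // scale1r.
Qed.
Fact hmulqV : {in [pred q | hnorm q != 0], right_inverse 1 hinv *%R}.
Proof.
move=> q; rewrite inE => nq; rewrite /hinv nq -scalerAr hmul_conj.
by rewrite scalerA mulVf // scale1r.
Qed.
Fact hunitP p q : q * p = 1 /\ p * q = 1 -> hnorm p != 0.
Proof.
case=> /(congr1 hnorm); rewrite hnormM hnorm1 => + _.
by apply: contra_eq_neq => ->; rewrite mulr0 eq_sym oner_eq0.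
Qed.
Fact hinv_out : {in [predC [pred q | hnorm q != 0]], hinv =1 id}.
Proof. by move=> q; rewrite !inE /hinv => /negbTE ->. Qed.

(* The unit ring axioms force the unit predicate to be two-sided invertibility
   in H_t and x^-1 to be the inverse of x whenever x is invertible. *)
HB.instance Definition _ := GRing.NzRing_hasMulInverse.Build (Ht t)
  hmulVq hmulqV hunitP hinv_out.

Definition hi : Ht t := hq t 0 1 0 0.
Definition hj : Ht t := hq t 0 0 1 0.
Definition hk : Ht t := hq t 0 0 0 1.

Lemma Ht_basis q : q = q`x0 *: 1 + q`x1 *: hi + q`x2 *: hj + q`x3 *: hk.
Proof. by apply: hqP; rewrite honeE /hone /hi /hj /hk !hE; ring. Qed.

Lemma Ht_table :
  (hi * hi = - 1) * (hj * hj = t *: 1) * (hk * hk = t *: 1) *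
  (hi * hj = hk) * (hj * hi = - hk) *
  (hj * hk = - (t *: hi)) * (hk * hj = t *: hi) *
  (hk * hi = hj) * (hi * hk = - hj).
Proof.
by do !split; apply: hqP;
  rewrite ?hmulE ?honeE /hmul /hi /hj /hk /hone !hE; ring.
Qed.

Definition hvec q : Ht t := q`x1 *: hi + q`x2 *: hj + q`x3 *: hk.

Definition Hstar : set (Ht t) := [set q | hvec q \is a GRing.unit].

Lemma HstarE q :
  Hstar q <-> - q`x1 ^+ 2 + t * (q`x2 ^+ 2 + q`x3 ^+ 2) != 0.
Proof.
rewrite /Hstar /= -oppr_eq0.
suff -> : - (- q`x1 ^+ 2 + t * (q`x2 ^+ 2 + q`x3 ^+ 2)) = hnorm (hvec q) by [].
by rewrite /hnorm /hvec /hi /hj /hk !hE; ring.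
Qed.

(* Along the basis vectors, 'D_1, 'D_hi, 'D_hj, 'D_hk are the partial
   derivatives with respect to x_0, x_1, x_2, x_3. *)
Definition Vt (f : Ht t -> Ht t) (q : Ht t) : Ht t :=
  'D_1 f q -
  (hvec q)^-1 * (q`x1 *: 'D_hi f q + q`x2 *: 'D_hj f q + q`x3 *: 'D_hk f q).

Definition C1_on (Om : set (Ht t)) (f : Ht t -> Ht t) : Prop :=
  forall e : Ht t, e \in [:: 1; hi; hj; hk] ->
  forall q, Om q -> derivable f q e /\ {for q, continuous ('D_e f)}.

(* 'D_e is a total operator, hence the explicit C^1 condition. *)
Definition kerVt (Om : set (Ht t)) (f : Ht t -> Ht t) : Prop :=
  C1_on Om f /\ forall q, Om q -> Vt f q = 0.

Definition mu (l : nat) (q : Ht t) : Ht t :=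
  hco l q *: (1 + q`x0 *: (hvec q)^-1).

(* A multi-index alpha is a function on 'I_3; alpha_l is its value at l - 1. *)
Definition mabs (a : 'I_3 -> nat) : nat := (\sum_(l < 3) a l)%N.
Definition mfact (a : 'I_3 -> nat) : nat := (\prod_(l < 3) (a l)`!)%N.

Definition mu_pow (a : 'I_3 -> nat) (q : Ht t) : Ht t :=
  \prod_(l < 3) mu l.+1 q ^+ a l.

Definition symprod (h : seq (Ht t)) : Ht t :=
  ((size h)`!%:R : R)^-1 *:
    \sum_(s : 'S_(size h)) \prod_(m < size h) h`_(s m).

Definition sym_ijk (a : 'I_3 -> nat) : Ht t :=
  symprod (nseq (a ord0) hi ++ nseq (a (inord 1)) hj ++ nseq (a (inord 2)) hk).

Definition hcoef (a : 'I_3 -> nat) (n : nat) : Ht t :=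
  (n`!%:R / (mfact a)%:R : R) *: sym_ijk a.

End Algebra.

Arguments Hstar {R} t _.
Arguments kerVt {R t} Om f.

(* Main.v *)
Require Import Defs.
From mathcomp Require Import all_boot all_order all_algebra all_fingroup.
From mathcomp Require Import all_classical all_reals all_analysis.
Import Order.TTheory GRing.Theory Num.Theory numFieldNormedType.Exports.
Local Open Scope classical_set_scope.
Local Open Scope ring_scope.

(** Put [v := hvec q] and [w := 1 + x0 v^-1].  Then [q = w v], [w] and [v]
    commute, and [mu_l = x_l w], so the expansion of [q ^+ n] amounts to that of
    [v ^+ n = (x1 i + x2 j + x3 k) ^+ n] as a sum over words of length [n] in
    [i, j, k], grouped by the number of occurrences of each letter.  The sum over
    permutations in the symmetrized product meets each such word exactly
    [alpha!] times, which identifies the grouped sums with the coefficients.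
    For the kernel, the derivative of [q ^+ n] along [e] is
    [\sum_(i < n) q ^+ i * e * q ^+ (n - 1 - i)]; it is linear in [e], and equals
    [n e q ^+ (n - 1)] for [e] commuting with [q], in particular for [e = 1] and
    [e = v], where the two terms of [Vt] cancel. *)

(** * Words, letter counts and permutations *)

Definition occ {C : eqType} {n : nat} (f : 'I_n -> C) (c : C) : nat :=
  (\sum_(m < n) (f m == c))%N.

Lemma occ_lift (C : eqType) (n : nat) (f : 'I_n.+1 -> C) (j : 'I_n.+1) (c : C) :
  occ f c = ((f j == c) + occ (fun m => f (lift j m)) c)%N.
Proof. by rewrite /occ (bigD1_ord j). Qed.

(** A permutation amounts to the image [j] of [ord0] and a permutation of the remaining points:
    [lift_perm ord0] is injective in this pair, and the cardinals agree. *)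
Lemma sum_perm_recl (n : nat) (F : 'S_n.+1 -> nat) :
  (\sum_s F s = \sum_(j < n.+1) \sum_(s : 'S_n) F (lift_perm ord0 j s))%N.
Proof.
pose L (p : 'I_n.+1 * 'S_n) := lift_perm ord0 p.1 p.2.
have L_inj : injective L.
  move=> [j s] [j' s'] /= /permP eqL.
  have := eqL ord0; rewrite /L /= !lift_perm_id => ejj; rewrite -ejj in eqL *.
  congr (_, _); apply/permP => m.
  by have := eqL (lift ord0 m); rewrite /L /= !lift_perm_lift => /lift_inj.
have L_bij : bijective L.
  apply: inj_card_bij L_inj _.
  by rewrite card_prod card_ord !card_Sn factS.
by rewrite (reindex L) ?pair_bigA //; apply: onW_bij.
Qed.

(** The product of truth values is the indicator of [g \o s = f], so the sum counts these [s]. By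
    induction: [s] sends [ord0] to one of the positions of the letter [f ord0] in [g], and deleting
    that position leaves two words with equal letter counts. *)
Lemma sum_perm_comp_eq (C : finType) (n : nat) (f g : 'I_n -> C) :
  (forall c, occ f c = occ g c) ->
  (\sum_(s : 'S_n) \prod_(m < n) (g (s m) == f m) = \prod_c (occ g c)`!)%N.
Proof.
elim: n f g => [|n IHn] f g eq_fg.
  under [LHS]eq_bigr do rewrite big_ord0.
  by rewrite sum1_card card_Sn big1 // => c _; rewrite /occ big_ord0.
rewrite sum_perm_recl.
have occ_f0 : (0 < occ g (f ord0))%N by rewrite -eq_fg (occ_lift _ _ _ ord0) eqxx.
(* The number of ways to complete an admissible [j], the same for each; there are [occ g (f ord0)]
   such [j], a positive number by [occ_f0]. *)
pose K := (\prod_(c | c != f ord0) (occ g c)`! * (occ g (f ord0)).-1`!)%N.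
have step j : (\sum_(s : 'S_n) \prod_(m < n.+1)
    (g (lift_perm ord0 j s m) == f m) = (g j == f ord0) * K)%N.
  under eq_bigr => s _.
    rewrite big_ord_recl lift_perm_id.
    under eq_bigr do rewrite lift_perm_lift.
    over.
  rewrite -big_distrr /=; have [gj|] := eqVneq; last by rewrite !mul0n.
  rewrite !mul1n (IHn (fun m => f (lift ord0 m)) (fun m => g (lift j m))).
    rewrite (bigD1 (f ord0)) //= mulnC; congr (_ * _)%N.
      apply: eq_bigr => c; rewrite (occ_lift _ _ g j) gj eq_sym => /negbTE ->.
      by rewrite add0n.
    by rewrite (occ_lift _ _ g j) gj eqxx.
  move=> c; have := eq_fg c; rewrite (occ_lift _ _ f ord0) (occ_lift _ _ g j) gj.
  exact: addnI.
under [LHS]eq_bigr do rewrite step.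
rewrite -big_distrl /= [RHS](bigD1 (f ord0)) //= /K mulnCA [in RHS]mulnC.
congr (_ * _)%N.
by rewrite -[in RHS](prednK occ_f0) factS prednK.
Qed.

(** Group the permutations by the word [g \o s], which fixes the noncommutative product;
    [sum_perm_comp_eq] gives the size of each fibre. *)
Lemma sum_perm_word (K : numFieldType) (A : algType K) (C : finType) (n : nat)
    (e : C -> A) (g : 'I_n -> C) :
  \sum_(s : 'S_n) \prod_(m < n) e (g (s m)) =
  (\prod_c (occ g c)`!)%:R *:
    \sum_(f : {ffun 'I_n -> C} | [forall c, occ f c == occ g c])
      \prod_(m < n) e (f m).
Proof.
rewrite (partition_big (fun s : 'S_n => [ffun m => g (s m)])
  (fun f : {ffun 'I_n -> C} => [forall c, occ f c == occ g c])) /=; last first.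
  move=> s _; apply/forallP => c; rewrite /occ [X in _ == X](reindex_perm s) /=.
  by apply/eqP; apply: eq_bigr => m _; rewrite ffunE.
rewrite scaler_sumr; apply: eq_bigr => f /forallP eq_fg.
rewrite -(sum_perm_comp_eq _ _ f) => [|c]; last exact/eqP.
rewrite scaler_nat -sumrMnr big_mkcond; apply: eq_bigr => s _.
have [<-|ne] := eqVneq.
  by rewrite [X in _ *+ X]big1 => [|m _]; [apply: eq_bigr => m _; rewrite ffunE | rewrite ffunE eqxx].
have [m nem] : exists m, g (s m) != f m.
  apply/existsP; rewrite -negb_forall; apply: contra ne => /forallP gs.
  by apply/eqP/ffunP => m; rewrite ffunE; apply/eqP.
by rewrite (bigD1 m) //= (negbTE nem) mul0n mulr0n.
Qed.

Lemma prodr_occ (K : comPzSemiRingType) (C : finType) (n : nat) (x : C -> K)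
    (f : 'I_n -> C) :
  \prod_(m < n) x (f m) = \prod_c x c ^+ occ f c.
Proof.
under [RHS]eq_bigr do rewrite /occ -prodrXr.
rewrite exchange_big; apply: eq_bigr => m _ /=.
rewrite (bigD1 (f m)) //= eqxx expr1 big1 ?mulr1 // => c.
by rewrite eq_sym => /negbTE ->; rewrite expr0.
Qed.

(** * Coefficients as sums over words, and powers of the vector part *)

Definition himag {R : realType} {t : R} (c : 'I_3) : Ht t :=
  [:: hi t; hj t; hk t]`_c.

Lemma hvec_sum (R : realType) (t : R) (q : Ht t) :
  hvec q = \sum_(c < 3) hco c.+1 q *: himag c.
Proof. by rewrite /hvec !big_ord_recl big_ord0 addr0 addrA. Qed.

(** Frees the type of the permutations from its dependence on [size h]. *)
Lemma symprod_sized (R : realType) (t : R) (n : nat) (h : seq (Ht t)) :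
  size h = n ->
  symprod h = (n`!%:R : R)^-1 *: \sum_(s : 'S_n) \prod_(m < n) h`_(s m).
Proof. by move<-. Qed.

Lemma hcoef_words (R : realType) (t : R) (n : nat) (a : 'I_3 -> nat) :
  mabs a = n ->
  hcoef t a n = \sum_(f : {ffun 'I_n -> 'I_3} | [forall c, occ f c == a c])
                  \prod_(m < n) himag (f m).
Proof.
(* The sorted word with letter counts [a]; its image under [himag] is the list in [sym_ijk]. *)
move=> an; pose w := nseq (a ord0) ord0 ++
  nseq (a (inord 1)) (inord 1 : 'I_3) ++ nseq (a (inord 2)) (inord 2).
have ord1E : lift ord0 ord0 = inord 1 :> 'I_3 by apply: val_inj; rewrite /= inordK.
have ord2E : lift ord0 (lift ord0 ord0) = inord 2 :> 'I_3.
  by apply: val_inj; rewrite /= inordK.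
have sw : size w = n.
  by rewrite -an /mabs !big_ord_recl big_ord0 addn0 !size_cat !size_nseq ord1E ord2E.
pose g (m : 'I_n) : 'I_3 := nth ord0 w m.
have occ_g c : occ g c = a c.
  transitivity (count_mem c w).
    rewrite /occ /g -sw -sum1_count [RHS]big_mkcond (big_nth ord0) big_mkord.
    by apply: eq_bigr => m _ /=; case: eqP.
  rewrite !count_cat !count_nseq.
  have /or3P[] : [|| c == ord0, c == inord 1 | c == inord 2].
    by rewrite -ord1E -ord2E; case: c => -[|[|[|[]]]].
  - by move=> /eqP->; rewrite /= -!val_eqE /= !inordK // mul1n !mul0n !addn0.
  - by move=> /eqP->; rewrite /= -!val_eqE /= !inordK // mul1n !mul0n addn0.
  - by move=> /eqP->; rewrite /= -!val_eqE /= !inordK // mul1n !mul0n.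
rewrite /hcoef /sym_ijk.
have -> : nseq (a ord0) (hi t) ++ nseq (a (inord 1)) (hj t) ++
    nseq (a (inord 2)) (hk t) = map himag w.
  by rewrite !map_cat !map_nseq /himag /= !inordK.
rewrite (symprod_sized _ _ n); last by rewrite size_map.
under eq_bigr => s _.
  under eq_bigr => m _ do rewrite (nth_map ord0) ?sw //.
  over.
rewrite (sum_perm_word _ _ _ _ himag g) !scalerA /mfact.
under eq_bigr do rewrite occ_g.
(* The factor [n!] cancels the normalization of [symprod]; then [mfact a] cancels the multiplicity
   of each word. *)
rewrite [X in X * _]mulrAC mulfV ?mul1r; last by rewrite pnatr_eq0 -lt0n fact_gt0.
rewrite mulVf ?scale1r; last first.
  by rewrite pnatr_eq0 -lt0n prodn_gt0 // => c; rewrite fact_gt0.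
by apply: eq_bigl => f; apply: eq_forallb => c; rewrite occ_g.
Qed.

Lemma sum_occ (C : finType) (n : nat) (f : 'I_n -> C) : (\sum_c occ f c)%N = n.
Proof.
rewrite exchange_big /= -[RHS](card_ord n) -sum1_card.
apply: eq_bigr => m _; rewrite (bigD1 (f m)) //= eqxx big1 // => c.
by rewrite eq_sym => /negbTE ->.
Qed.

Lemma hvec_exp (R : realType) (t : R) (n : nat) (q : Ht t) :
  hvec q ^+ n = \sum_(a : {ffun 'I_3 -> 'I_n.+1} | mabs (fun l => a l) == n)
    (\prod_(l < 3) hco l.+1 q ^+ a l) *: hcoef t (fun l => a l) n.
Proof.
(* Letter counts of a word of length [n] are at most [n], so they form an index of the finite
   sum. *)
have occ_le (f : {ffun 'I_n -> 'I_3}) c : (occ f c < n.+1)%N.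
  by rewrite ltnS -[leqRHS](sum_occ _ _ f) (bigD1 c) //= leq_addr.
pose p (f : {ffun 'I_n -> 'I_3}) : {ffun 'I_3 -> 'I_n.+1} :=
  [ffun c => Ordinal (occ_le f c)].
rewrite -[in LHS](card_ord n) -prodr_const hvec_sum bigA_distr_bigA /=.
rewrite (partition_big p (fun a : {ffun 'I_3 -> 'I_n.+1} =>
  mabs (fun l => a l) == n)) /=; last first.
  move=> f _; apply/eqP; rewrite -[RHS](sum_occ _ _ f).
  by apply: eq_bigr => c _; rewrite ffunE.
apply: eq_bigr => a /eqP an; rewrite hcoef_words // scaler_sumr.
apply: eq_big => [f|f /eqP fa].
  apply/eqP/forallP => [<- c|fa]; first by rewrite ffunE.
  by apply/ffunP => c; apply/val_inj; rewrite /p ffunE /=; apply/eqP/fa.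
rewrite scaler_prod (prodr_occ _ _ _ (fun c : 'I_3 => hco c.+1 q)).
by congr (_ *: _); apply: eq_bigr => c _; rewrite -fa ffunE.
Qed.

(** * Factorization through the vector part and the expansion *)

Lemma hvec_comm (R : realType) (t : R) (q : Ht t) : GRing.comm q (hvec q).
Proof.
have qE : q = hco 0 q *: 1 + hvec q by rewrite {1}(Ht_basis q) /hvec !addrA.
move: (hvec q) (hco 0 q) qE => v x0 ->.
by rewrite /GRing.comm mulrDl mulrDr -scalerAl -scalerAr mul1r mulr1.
Qed.

Lemma hvec_factor (R : realType) (t : R) (q : Ht t) :
  hvec q \is a GRing.unit -> q = (1 + hco 0 q *: (hvec q)^-1) * hvec q.
Proof.
move=> vu; rewrite mulrDl mul1r -scalerAl mulVr //.
by rewrite {1}(Ht_basis q) /hvec -!addrA addrC !addrA.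
Qed.

(** The three [mu l] are real multiples of one element, so its powers combine despite
    noncommutativity. *)
Lemma mu_powE (R : realType) (t : R) (a : 'I_3 -> nat) (q : Ht t) :
  mu_pow a q = (\prod_(l < 3) hco l.+1 q ^+ a l) *:
    (1 + hco 0 q *: (hvec q)^-1) ^+ mabs a.
Proof.
rewrite /mu_pow /mu.
under eq_bigr do rewrite exprZn.
by rewrite scaler_prod prodrXr.
Qed.

Lemma exp_mu (R : realType) (t : R) (n : nat) (q : Ht t) : Hstar t q ->
  q ^+ n = \sum_(a : {ffun 'I_3 -> 'I_n.+1} | mabs (fun l => a l) == n)
             mu_pow (fun l => a l) q * hcoef t (fun l => a l) n.
Proof.
rewrite /Hstar /= => vu.
rewrite {1}(hvec_factor _ _ _ vu) exprMn_comm; last first.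
  move: (hvec q) vu => v vu.
  by rewrite /GRing.comm mulrDl mulrDr mul1r mulr1 -scalerAl -scalerAr mulVr ?mulrV.
rewrite hvec_exp mulr_sumr; apply: eq_bigr => a /eqP an.
by rewrite mu_powE an -scalerAl -scalerAr.
Qed.

(** * Continuity of the product and of powers *)

Lemma cvg_coord {R : realType} {t : R} {T : Type} {F : set_system T}
    {FF : Filter F} {f : T -> Ht t} {a : Ht t} (l : nat) :
  f @ F --> a -> hco l (f x) @[x --> F] --> hco l a.
Proof.
move=> fa; apply: (cvg_comp _ _ fa).
exact: (@coord_continuous R 1 4 0 (inord l) a).
Qed.

Lemma hmul_coords (R : realType) (t : R) (p q : Ht t) :
  p * q = hco 0 p *: q + hco 1 p *: (hi t * q) + hco 2 p *: (hj t * q) +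
          hco 3 p *: (hk t * q).
Proof. by rewrite {1}(Ht_basis p) !mulrDl -!scalerAl mul1r. Qed.

(** Bilinearity reduces this to scaling by convergent coordinates: first in the right factor, with a
    constant on the left, then in the left factor. *)
Lemma cvg_hmul {R : realType} {t : R} {T : Type} {F : set_system T}
    {FF : Filter F} {f g : T -> Ht t} {a b : Ht t} :
  f @ F --> a -> g @ F --> b -> f x * g x @[x --> F] --> a * b.
Proof.
move=> fa gb.
have mulc c : c * g x @[x --> F] --> c * b.
  rewrite (Ht_basis b) !mulrDr -!scalerAr.
  under eq_cvg do rewrite (Ht_basis (g _)) !mulrDr -!scalerAr.
  by apply: cvgD; [apply: cvgD; [apply: cvgD |] |]; (apply: cvgZ; [exact: cvg_coord | exact: cvg_cst]).
rewrite hmul_coords; under eq_cvg do rewrite hmul_coords.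
by apply: cvgD; [apply: cvgD; [apply: cvgD |] |]; (apply: cvgZ; first exact: cvg_coord).
Qed.

Lemma continuous_exp (R : realType) (t : R) (n : nat) :
  continuous (fun q : Ht t => q ^+ n).
Proof.
elim: n => [|n IHn] q.
  rewrite (_ : (fun _ => _) = cst 1); first exact: cst_continuous.
  by apply/funext => p; rewrite expr0.
rewrite /continuous_at exprS; under eq_cvg do rewrite exprS.
exact: (cvg_hmul (@cvg_id _ (nbhs q)) (IHn q)).
Qed.

(** * Directional derivatives of powers *)

Definition dexp {A : pzRingType} (n : nat) (e q : A) : A :=
  \sum_(i < n) q ^+ i * e * q ^+ (n.-1 - i).

Lemma dexpS (A : pzRingType) (n : nat) (e q : A) :
  dexp n.+1 e q = dexp n e q * q + q ^+ n * e.
Proof.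
rewrite /dexp big_ord_recr /= subnn mulr1; congr (_ + _).
rewrite mulr_suml; apply: eq_bigr => i _; rewrite -!mulrA -exprSr.
(* The exponents [n.-1 - i] and [n - i] differ by exactly one because [i < n]: the subtraction does
   not truncate. *)
by congr (_ * (_ * _ ^+ _)); case: n i => [[]//|n] i; rewrite subSn // -ltnS.
Qed.

Lemma dexp_comm (A : pzRingType) (n : nat) (e q : A) : GRing.comm q e ->
  dexp n e q = (e * q ^+ n.-1) *+ n.
Proof.
move=> qe; rewrite /dexp (eq_bigr (fun=> e * q ^+ n.-1)) => [|i _].
  by rewrite sumr_const card_ord.
rewrite -(commrX _ (commr_sym qe)) -mulrA -exprD subnKC //.
by case: n i => [[]|n i] //=; rewrite -ltnS.
Qed.

Lemma continuous_dexp (R : realType) (t : R) (n : nat) (e : Ht t) :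
  continuous (dexp n e).
Proof.
elim: n => [|n IHn] q.
  rewrite (_ : dexp 0 e = cst 0); first exact: cst_continuous.
  by apply/funext => p; rewrite /dexp big_ord0.
rewrite /continuous_at dexpS; under eq_cvg do rewrite dexpS.
exact: (cvgD (cvg_hmul (IHn q) (@cvg_id _ (nbhs q)))
  (cvg_hmul (continuous_exp _ _ n q) (cvg_cst e))).
Qed.

(** Induction by the Leibniz rule: with [p = h *: e + q], [p ^+ n.+1 - q ^+ n.+1 = (p ^+ n - q ^+ n)
    * p + h *: (q ^+ n * e)], which matches [dexpS] in the limit. *)
Lemma cvg_diff_quot_exp (R : realType) (t : R) (n : nat) (e q : Ht t) :
  h^-1 *: ((h *: e + q) ^+ n - q ^+ n) @[h --> (0 : R)^'] --> dexp n e q.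
Proof.
elim: n => [|n IHn].
  rewrite /dexp big_ord0; under eq_cvg do rewrite subrr scaler0.
  exact: cvg_cst.
rewrite dexpS.
have shift_cvg : h *: e + q @[h --> (0 : R)^'] --> q.
  rewrite -[X in _ --> X]add0r -(scale0r e); apply: cvgD; last exact: cvg_cst.
  by apply: cvgZ; [exact: nbhs_dnbhs | exact: cvg_cst].
have lim_sum : h^-1 *: ((h *: e + q) ^+ n - q ^+ n) * (h *: e + q) + q ^+ n * e
    @[h --> (0 : R)^'] --> dexp n e q * q + q ^+ n * e.
  exact: (cvgD (cvg_hmul IHn shift_cvg) (cvg_cst (q ^+ n * e))).
apply: cvg_trans lim_sum; apply: near_eq_cvg; near=> h.
have h0 : h != 0 by near: h; exact: nbhs_dnbhs_neq.
apply: (scalerI h0); rewrite scalerDr -scalerAl !scalerA !mulfV // !scale1r.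
rewrite !exprSr mulrBl [X in _ - X + _]mulrDr opprD -scalerAr.
by rewrite [- _ - _]addrC addrA subrK.
Unshelve. all: by end_near. Qed.

Lemma is_derive_exp (R : realType) (t : R) (n : nat) (e q : Ht t) :
  is_derive q e (fun p : Ht t => p ^+ n) (dexp n e q).
Proof.
have dq := cvg_diff_quot_exp _ _ n e q.
by apply: DeriveDef; [apply/cvg_ex; exists (dexp n e q) | apply: cvg_lim].
Qed.

Theorem proposition3p9 (R : realType) (t : R) (ht : t != 0) (n : nat) :
  kerVt (Hstar t) (fun q : Ht t => q ^+ n) /\
  forall q : Ht t, Hstar t q ->
    q ^+ n = \sum_(a : {ffun 'I_3 -> 'I_n.+1} | mabs (fun l => a l) == n)
               mu_pow (fun l => a l) q * hcoef t (fun l => a l) n.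
Proof.
have DE e q : 'D_e (fun p : Ht t => p ^+ n) q = dexp n e q.
  by case: (is_derive_exp R t n e q).
split; last by move=> q; exact: exp_mu.
split=> [e _ q _|q]; last rewrite /Hstar /= => vu.
  split; first by case: (is_derive_exp R t n e q).
  by rewrite (_ : 'D_e _ = dexp n e); [exact: continuous_dexp | apply/funext => p].
rewrite /Vt !DE.
(* Linearity of [dexp] in its direction turns the weighted partial derivatives into one derivative
   along [hvec q]. *)
have -> : hco 1 q *: dexp n (hi t) q + hco 2 q *: dexp n (hj t) q +
    hco 3 q *: dexp n (hk t) q = dexp n (hvec q) q.
  rewrite /dexp !scaler_sumr -!big_split; apply: eq_bigr => i _.
  by rewrite /hvec !mulrDr !mulrDl -!scalerAr -!scalerAl.
rewrite !dexp_comm; [|exact: hvec_comm|exact: commr1].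
by rewrite mulrnAr mulKr // mul1r subrr.
Qed.
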